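(* Let $\lambda=(\lambda_1,\lambda_2)$, $\gamma=(\gamma_1,\gamma_2)$, $\mu=(\mu_1,\mu_2)$ be weakly decreasing pairs of nonnegative real numbers with the same total sum and with $\lambda\succ\gamma\succ\mu$. Then $$J_\lambda(x,y)+J_\mu(x,y)-2J_\gamma(x,y)\ge 0\qquad\text{for all real }x,y>0$$ if and only if $$\tfrac12\left(\|\lambda\|_2^2+\|\mu\|_2^2-2\|\gamma\|_2^2\right)\ge 0.$$
   Context: For a pair $\eta=(\eta_1,\eta_2)$ of nonnegative reals, $J_\eta(x,y)=x^{\eta_1}y^{\eta_2}+x^{\eta_2}y^{\eta_1}$ (both labeled permutations are counted, also when $\eta_1=\eta_2$). For weakly decreasing pairs $a,b$ with the same total sum, $a\succcurlyeq b$ means $a_1\ge b_1$; $a\succ b$ means $a\succcurlyeq b$ and $a\neq b$. $\|\cdot\|_2$ is the Euclidean norm. *)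

(* Defs.v *)
From Stdlib Require Import Reals.
From Coquelicot Require Import Coquelicot.
Open Scope R_scope.

Definition nonneg_pair (a : R * R) : Prop := 0 <= fst a /\ 0 <= snd a.

Definition weakly_decreasing (a : R * R) : Prop := fst a >= snd a.

Definition total (a : R * R) : R := fst a + snd a.

(* Meaningful for weakly decreasing pairs with equal totals; these conditions
   are not part of the relation and must be assumed separately. *)
Definition majorizes (a b : R * R) : Prop := fst a >= fst b.

Definition strictly_majorizes (a b : R * R) : Prop := majorizes a b /\ a <> b.

(* Rpower is the usual real power for positive bases only. *)
Definition J (eta : R * R) (x y : R) : R :=
  Rpower x (fst eta) * Rpower y (snd eta)
  + Rpower x (snd eta) * Rpower y (fst eta).

(* Coquelicot's product norm is sqrt (norm (fst a) ^ 2 + norm (snd a) ^ 2),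
   which is the Euclidean norm on R * R. *)
Definition norm2 (a : R * R) : R :=
  @norm R_AbsRing (prod_NormedModule R_AbsRing R_NormedModule R_NormedModule) a.

(* Main.v *)
(** With [u = ln x - ln y] and [d = eta_1 - eta_2], the function [J eta x y] is a
positive factor depending only on the total of [eta] times [2 cosh (d u / 2)], while
[2 ||eta||^2 = total^2 + d^2].  This reduces to showing that
[cosh (a t) + cosh (c t) >= 2 cosh (b t)] for all [t] iff [a^2 + c^2 >= 2 b^2].
The condition is necessary by looking at second order at [t = 0], and sufficient because
the even Taylor coefficients satisfy [a^(2m) + c^(2m) >= 2 b^(2m)] by the power mean
inequality. *)

Require Import Defs.
From Stdlib Require Import Reals Lra Arith Factorial.
From Coquelicot Require Import Coquelicot.
Open Scope R_scope.

(** By induction on [m]: since [a - c] and [a ^ m - c ^ m] have the same sign, [2 * (a ^ S m + c ^ S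
    m) >= (a + c) * (a ^ m + c ^ m)], and the right side is at least [2 * b * (2 * b ^ m)]. *)
Lemma pow_sum_ge (a b c : R) (m : nat) :
  0 <= a -> 0 <= b -> 0 <= c -> 2 * b <= a + c -> 2 * b ^ m <= a ^ m + c ^ m.
Proof.
  intros Ha Hb Hc H.
  induction m as [|m IH]; simpl; [lra|].
  assert (Hbm : 0 <= b ^ m) by now apply pow_le.
  assert (Chebyshev : 0 <= (a - c) * (a ^ m - c ^ m)).
  { destruct (Rle_dec a c) as [Hac|Hac].
    - assert (a ^ m <= c ^ m) by (apply pow_incr; lra). nra.
    - assert (c ^ m <= a ^ m) by (apply pow_incr; lra). nra. }
  nra.
Qed.

(** Termwise comparison of the series of [exp z + exp (- z)]: odd powers cancel, and even ones are
    powers of the squares. *)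
Lemma pow_opp_sum_ge (a b c : R) (k : nat) :
  2 * b ^ 2 <= a ^ 2 + c ^ 2 ->
  2 * (b ^ k + (- b) ^ k) <= (a ^ k + (- a) ^ k) + (c ^ k + (- c) ^ k).
Proof.
  intros H.
  destruct (Nat.Even_or_Odd k) as [[m ->]|[m ->]].
  - rewrite !pow_mult.
    replace ((- a) ^ 2) with (a ^ 2) by ring.
    replace ((- b) ^ 2) with (b ^ 2) by ring.
    replace ((- c) ^ 2) with (c ^ 2) by ring.
    assert (P := pow_sum_ge (a ^ 2) (b ^ 2) (c ^ 2) m
                   (pow2_ge_0 a) (pow2_ge_0 b) (pow2_ge_0 c) H).
    lra.
  - assert (Hodd : forall z, (- z) ^ (2 * m + 1) = - z ^ (2 * m + 1)).
    { intros z. rewrite !pow_add, !pow_mult, !pow_1.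
      replace ((- z) ^ 2) with (z ^ 2) by ring. ring. }
    rewrite !Hodd. lra.
Qed.

Lemma cosh_sum_ge (a b c : R) :
  2 * b ^ 2 <= a ^ 2 + c ^ 2 -> 2 * cosh b <= cosh a + cosh c.
Proof.
  intros H.
  (* [E1 z n] is the partial sum of the exponential series up to degree [n]. *)
  assert (Hlim : forall z, is_lim_seq (fun n => E1 z n + E1 (- z) n) (2 * cosh z)).
  { intros z. replace (2 * cosh z) with (exp z + exp (- z)) by (unfold cosh; field).
    apply is_lim_seq_plus'; apply is_lim_seq_Reals, E1_cvg. }
  assert (Hle : Rbar_le (2 * (2 * cosh b)) (2 * cosh a + 2 * cosh c)).
  { apply (is_lim_seq_le
      (fun n => 2 * (E1 b n + E1 (- b) n))
      (fun n => (E1 a n + E1 (- a) n) + (E1 c n + E1 (- c) n))).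
    - intros n. unfold E1. rewrite <- !plus_sum, scal_sum.
      apply sum_Rle. intros k _.
      assert (P := pow_opp_sum_ge a b c k H).
      assert (0 < / INR (fact k)) by apply Rinv_0_lt_compat, INR_fact_lt_0.
      nra.
    - exact (is_lim_seq_scal_l _ 2 _ (Hlim b)).
    - apply is_lim_seq_plus'; apply Hlim. }
  simpl in Hle. lra.
Qed.

(** The quotient is the difference quotient at 0 of [sinh (a * t)], whose derivative there is
    [a]. *)
Lemma is_lim_sinh_div (a : R) : is_lim (fun t => sinh (a * t) / t) 0 a.
Proof.
  assert (D : derivable_pt_lim (fun t => sinh (a * t)) 0 a).
  { apply is_derive_Reals. unfold sinh. auto_derive; [easy|].
    rewrite Rmult_0_r, Ropp_0, exp_0. field. }
  apply is_lim_spec. intros eps.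
  destruct (D eps (cond_pos eps)) as [delta Hdelta].
  exists delta. intros t Ht Ht0.
  change (Rabs (t - 0) < delta) in Ht.
  rewrite Rminus_0_r in Ht.
  specialize (Hdelta t Ht0 Ht).
  now rewrite Rplus_0_l, Rmult_0_r, sinh_0, Rminus_0_r in Hdelta.
Qed.

(** Reduces second-order behaviour of [cosh] at 0 to first-order behaviour of [sinh]. *)
Lemma cosh_double (x : R) : cosh (2 * x) = 1 + 2 * sinh x ^ 2.
Proof.
  unfold cosh, sinh.
  replace (2 * x) with (x + x) by ring.
  rewrite Ropp_plus_distr, !exp_plus, exp_Ropp.
  field. apply Rgt_not_eq, exp_pos.
Qed.

Lemma cosh_sum_ge_iff (a b c : R) :
  (forall t, 2 * cosh (b * t) <= cosh (a * t) + cosh (c * t)) <->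
  2 * b ^ 2 <= a ^ 2 + c ^ 2.
Proof.
  split.
  - intros H.
    assert (Hlim : forall z, is_lim (fun t => sinh (z * t) / t * (sinh (z * t) / t)) 0 (z * z)).
    { intros z. apply (is_lim_mult _ _ 0 z z); [apply is_lim_sinh_div..|easy]. }
    assert (Hle : Rbar_le (2 * (b * b)) (a * a + c * c)).
    { apply (is_lim_le_loc
        (fun t => 2 * (sinh (b * t) / t * (sinh (b * t) / t)))
        (fun t => sinh (a * t) / t * (sinh (a * t) / t)
                  + sinh (c * t) / t * (sinh (c * t) / t)) 0).
      - exists (mkposreal 1 Rlt_0_1). intros t _ Ht0.
        (* At [2 * t] the double-angle formula makes the constants cancel, leaving an inequality
           between squares of [sinh] to be divided by [t ^ 2]. *)
        specialize (H (2 * t)).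
        replace (b * (2 * t)) with (2 * (b * t)) in H by ring.
        replace (a * (2 * t)) with (2 * (a * t)) in H by ring.
        replace (c * (2 * t)) with (2 * (c * t)) in H by ring.
        rewrite !cosh_double in H.
        assert (Hsq : forall z, z / t * (z / t) = / t ^ 2 * z ^ 2) by (intros; now field).
        rewrite !Hsq.
        assert (0 < / t ^ 2) by now apply Rinv_0_lt_compat, pow2_gt_0.
        nra.
      - exact (is_lim_scal_l _ 2 0 _ (Hlim b)).
      - now apply (is_lim_plus' _ _ 0 (a * a) (c * c)). }
    simpl in Hle. lra.
  - intros H t. apply cosh_sum_ge.
    rewrite !Rpow_mult_distr. assert (0 <= t ^ 2) by apply pow2_ge_0. nra.
Qed.

(** Each exponent [p * ln x + q * ln y] splits as [(p + q) * (ln x + ln y) / 2 + (p - q) * (ln x -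
    ln y) / 2]; swapping [p] and [q] flips only the second term. *)
Lemma J_cosh (eta : R * R) (x y : R) :
  J eta x y = 2 * exp (total eta * ((ln x + ln y) / 2))
              * cosh ((fst eta - snd eta) * ((ln x - ln y) / 2)).
Proof.
  unfold J, total, cosh, Rpower, Rdiv.
  rewrite <- !exp_plus.
  match goal with |- _ = 2 * ?e * ((?p + ?q) * / 2) =>
    replace (2 * e * ((p + q) * / 2)) with (e * p + e * q) by field end.
  rewrite <- !exp_plus.
  f_equal; f_equal; field.
Qed.

(** The parallelogram identity for two reals. *)
Lemma norm2_pow2 (eta : R * R) :
  norm2 eta ^ 2 = (total eta ^ 2 + (fst eta - snd eta) ^ 2) / 2.
Proof.
  unfold norm2, total.
  change (sqrt (Rabs (fst eta) ^ 2 + Rabs (snd eta) ^ 2) ^ 2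
          = ((fst eta + snd eta) ^ 2 + (fst eta - snd eta) ^ 2) / 2).
  rewrite pow2_sqrt, !pow2_abs; [field|].
  apply Rplus_le_le_0_compat; apply pow2_ge_0.
Qed.

Theorem theorem3p1 (lambda gamma mu : R * R)
  (lambda_nonneg : nonneg_pair lambda)
  (gamma_nonneg : nonneg_pair gamma)
  (mu_nonneg : nonneg_pair mu)
  (lambda_decr : weakly_decreasing lambda)
  (gamma_decr : weakly_decreasing gamma)
  (mu_decr : weakly_decreasing mu)
  (total_lambda_gamma : total lambda = total gamma)
  (total_gamma_mu : total gamma = total mu)
  (lambda_gamma : strictly_majorizes lambda gamma)
  (gamma_mu : strictly_majorizes gamma mu) :
  (forall x y : R, x > 0 -> y > 0 ->
     J lambda x y + J mu x y - 2 * J gamma x y >= 0)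
  <->
  1 / 2 * (norm2 lambda ^ 2 + norm2 mu ^ 2 - 2 * norm2 gamma ^ 2) >= 0.
Proof.
  assert (Hcosh := cosh_sum_ge_iff (fst lambda - snd lambda) (fst gamma - snd gamma)
                     (fst mu - snd mu)).
  rewrite !norm2_pow2, total_lambda_gamma, total_gamma_mu.
  split.
  - intros H.
    apply Rle_ge.
    enough (2 * (fst gamma - snd gamma) ^ 2
            <= (fst lambda - snd lambda) ^ 2 + (fst mu - snd mu) ^ 2) by lra.
    apply Hcosh. intros t.
    (* On the curve [x * y = 1] the exponential prefactor is 1 and [(ln x - ln y) / 2] is [t]. *)
    specialize (H (exp t) (exp (- t)) (exp_pos _) (exp_pos _)).
    rewrite !J_cosh, !ln_exp in H.
    replace ((t + - t) / 2) with 0 in H by field.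
    replace ((t - - t) / 2) with t in H by field.
    rewrite !Rmult_0_r, exp_0 in H.
    lra.
  - intros H x y _ _.
    rewrite !J_cosh, total_lambda_gamma, total_gamma_mu.
    assert (P := proj2 Hcosh ltac:(lra) ((ln x - ln y) / 2)).
    (* Equal totals give all three terms this same positive factor. *)
    assert (0 < exp (total mu * ((ln x + ln y) / 2))) by apply exp_pos.
    nra.
Qed.
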